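(* Let $f:(X,d)\to(Y,\rho)$ be a map between two quasi-metric spaces $(X,d)$ and $(Y,\rho)$. If $(Y,\rho)$ has the property that forward parallel implies backward parallel, then the following are equivalent: (a) $f$ is left K-Cauchy regular; (b) for every real-valued forward uniformly continuous map $h:(Y,\rho)\to(\mathbb{R},|\cdot|)$, the map $h\circ f:(X,d)\to(\mathbb{R},|\cdot|)$ is left K-Cauchy regular.
   Context: A quasi-metric on a set $X$ is a function $d:X\times X\to\mathbb{R}$ such that for all $x,y,z\in X$: $d(x,y)\ge 0$ and $d(x,x)=0$; $d(x,y)=0=d(y,x)$ implies $x=y$; and $d(x,y)\le d(x,z)+d(z,y)$ (symmetry is not required). $(\mathbb{R},|\cdot|)$ is the real line with its usual metric. For sequences in a quasi-metric space $(Y,\rho)$, $(x_n)$ is forward parallel to $(y_n)$ if $\rho(x_n,y_n)\to 0$, and backward parallel to $(y_n)$ if $\rho(y_n,x_n)\to 0$. The property ''forward parallel implies backward parallel'' means: for all sequences $(x_n),(y_n)$ in $Y$, if $(x_n)$ is forward parallel to $(y_n)$ then $(x_n)$ is backward parallel to $(y_n)$. A sequence $(x_n)$ in $(X,d)$ is left K-Cauchy if for every $\epsilon>0$ there is $n_0\in\mathbb{N}$ such that $d(x_k,x_n)<\epsilon$ whenever $n_0\le k\le n$. A map between quasi-metric spaces is left K-Cauchy regular if it maps left K-Cauchy sequences to left K-Cauchy sequences. A map $f:(X,d)\to(Y,\rho)$ is forward uniformly continuous if for every $\epsilon>0$ there is $\delta>0$ such that $\rho(f(x),f(y))<\epsilon$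 whenever $d(x,y)<\delta$. *)

(* Defs.v *)
From HB Require Import structures.
From mathcomp Require Import all_boot all_order all_algebra.
From mathcomp Require Import all_classical all_reals all_analysis.

Set Implicit Arguments.
Unset Strict Implicit.
Unset Printing Implicit Defensive.

Import Order.TTheory GRing.Theory Num.Theory.
Import numFieldNormedType.Exports.

Local Open Scope classical_set_scope.
Local Open Scope ring_scope.

Record is_quasi_metric (R : realType) (X : Type) (d : X -> X -> R) : Prop :=
  IsQuasiMetric {
    qm_ge0 : forall x y, 0 <= d x y;
    qm_refl : forall x, d x x = 0;
    qm_sep : forall x y, d x y = 0 -> d y x = 0 -> x = y;
    qm_triangle : forall x y z, d x y <= d x z + d z y
  }.

Definition real_dist (R : realType) (x y : R) : R := `|x - y|.

Lemma real_dist_quasi_metric (R : realType) : is_quasi_metric (@real_dist R).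
Proof.
split=> [x y|x|x y /eqP|x y z]; rewrite /real_dist.
- exact: normr_ge0.
- by rewrite subrr normr0.
- by rewrite normr_eq0 subr_eq0 => /eqP.
- exact: ler_distD.
Qed.

Definition forward_parallel (R : realType) (Y : Type) (rho : Y -> Y -> R)
    (x y : nat -> Y) : Prop :=
  rho (x n) (y n) @[n --> \oo] --> (0 : R).

Definition backward_parallel (R : realType) (Y : Type) (rho : Y -> Y -> R)
    (x y : nat -> Y) : Prop :=
  rho (y n) (x n) @[n --> \oo] --> (0 : R).

Definition forward_parallel_implies_backward_parallel (R : realType)
    (Y : Type) (rho : Y -> Y -> R) : Prop :=
  forall x y : nat -> Y, forward_parallel rho x y -> backward_parallel rho x y.

Definition left_K_Cauchy (R : realType) (X : Type) (d : X -> X -> R)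
    (x : nat -> X) : Prop :=
  forall eps : R, 0 < eps -> exists n0 : nat, forall k n : nat,
    (n0 <= k)%N -> (k <= n)%N -> d (x k) (x n) < eps.

Definition left_K_Cauchy_regular (R : realType) (X Y : Type)
    (d : X -> X -> R) (rho : Y -> Y -> R) (f : X -> Y) : Prop :=
  forall x : nat -> X, left_K_Cauchy d x -> left_K_Cauchy rho (f \o x).

Definition forward_uniformly_continuous (R : realType) (X Y : Type)
    (d : X -> X -> R) (rho : Y -> Y -> R) (f : X -> Y) : Prop :=
  forall eps : R, 0 < eps -> exists2 delta : R, 0 < delta &
    forall x y : X, d x y < delta -> rho (f x) (f y) < eps.

(* Main.v *)
Require Import Defs.
From mathcomp Require Import all_boot all_order all_algebra.
From mathcomp Require Import all_classical all_reals all_analysis.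
From mathcomp Require Import lra.

(** Since forward parallel implies backward parallel, [rho] is uniformly
equivalent to the symmetric metric [D x y = rho x y + rho y x], so it suffices
to show that a sequence [y] is [D]-Cauchy as soon as every [D]-nonexpansive
real function maps it to a Cauchy sequence.  If every ball radius admits a point
[y m] to which [y] returns infinitely often, nonexpansiveness of [D (y m)]
upgrades "infinitely often" to "eventually" and [y] is Cauchy.  Otherwise [y]
has an [e]-separated subsequence, and the distance to its even-indexed terms is
a nonexpansive function that oscillates along [y]. *)

Set Implicit Arguments.
Unset Strict Implicit.
Unset Printing Implicit Defensive.

Import Order.TTheory GRing.Theory Num.Theory.
Import numFieldNormedType.Exports.

Local Open Scope classical_set_scope.
Local Open Scope ring_scope.

Lemma forward_uniformly_continuous_regular (R : realType) (X Y : Type)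
    (d : X -> X -> R) (rho : Y -> Y -> R) (f : X -> Y) :
  forward_uniformly_continuous d rho f -> left_K_Cauchy_regular d rho f.
Proof.
move=> uf x cx e /uf[s s0 sP]; have [n0 n0P] := cx _ s0.
by exists n0 => k n le_k le_n; apply: sP; apply: n0P.
Qed.

(** Turns the sequential hypothesis into a uniform one: if no [s] worked for [e], choosing a bad
    pair for each [s = 1/(n+1)] would give forward parallel sequences whose reverse distances stay
    at least [e]. *)
Lemma parallel_uniform (R : realType) (Y : Type) (rho : Y -> Y -> R) :
  is_quasi_metric rho -> forward_parallel_implies_backward_parallel rho ->
  forall e : R, 0 < e -> exists2 s : R, 0 < s &
    forall x y, rho x y < s -> rho y x < e.
Proof.
move=> hrho hY e e0; apply: contrapT => nosmall.
have /choice[p pP] (n : nat) :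
    exists q : Y * Y, rho q.1 q.2 < n.+1%:R^-1 /\ e <= rho q.2 q.1.
  apply: contrapT => noq; apply: nosmall; exists n.+1%:R^-1 => // x y xy.
  by rewrite ltNge; apply/negP => yx; apply: noq; exists (x, y).
have fwd : forward_parallel rho (fst \o p) (snd \o p).
  apply: (squeeze_cvgr _ (cvg_cst 0) (@cvg_harmonic R)).
  by apply: nearW => n; rewrite qm_ge0 //= ltW //; case: (pP n).
have /cvgrPdist_lt/(_ _ e0)[N _ /(_ N (leqnn N))] := hY _ _ fwd.
rewrite /= sub0r normrN ger0_norm ?qm_ge0 //.
by rewrite ltNge; case: (pP N) => _ ->.
Qed.

Definition symmetrized (R : realType) (Y : Type) (rho : Y -> Y -> R)
    (x y : Y) : R := rho x y + rho y x.

Lemma symmetrizedC (R : realType) (Y : Type) (rho : Y -> Y -> R) x y :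
  symmetrized rho x y = symmetrized rho y x.
Proof. exact: addrC. Qed.

Lemma symmetrized_quasi_metric (R : realType) (Y : Type) (rho : Y -> Y -> R) :
  is_quasi_metric rho -> is_quasi_metric (symmetrized rho).
Proof.
move=> h; split=> [x y|x|x y Dxy _|x y z]; rewrite /symmetrized.
- by apply: addr_ge0; apply: (qm_ge0 h).
- by rewrite !(qm_refl h) addr0.
- rewrite /symmetrized in Dxy.
  have := qm_ge0 h x y; have := qm_ge0 h y x => yx0 xy0.
  by apply: (qm_sep h); lra.
- have := qm_triangle h x y z; have := qm_triangle h y x z; lra.
Qed.

Section nonexpansive.
Context (R : realType) (Y : Type) (D : Y -> Y -> R).
Hypotheses (hD : is_quasi_metric D) (DC : forall x y, D x y = D y x).

Definition nonexpansive (h : Y -> R) : Prop :=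
  forall x y, real_dist (h x) (h y) <= D x y.

Definition dist_to (z : nat -> Y) (x : Y) : R := inf (range (fun n => D x (z n))).

Lemma dist_to_le (z : nat -> Y) x n : dist_to z x <= D x (z n).
Proof.
apply: ge_inf; last by exists n.
by exists 0 => _ [m _ <-]; apply: (qm_ge0 hD).
Qed.

Lemma le_dist_to (z : nat -> Y) x e :
  (forall n, e <= D x (z n)) -> e <= dist_to z x.
Proof.
move=> ez; apply: lb_le_inf; first by exists (D x (z 0%N)), 0%N.
by move=> _ [n _ <-].
Qed.

(** By the triangle inequality, [dist_to z x - D x y] is a lower bound of every [D y (z n)], hence
    of their infimum; symmetry of [D] gives the other half. *)
Lemma nonexpansive_dist_to (z : nat -> Y) : nonexpansive (dist_to z).
Proof.
have half x y : dist_to z x - D x y <= dist_to z y.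
  apply: le_dist_to => n.
  have := dist_to_le z x n; have := qm_triangle hD x (z n) y; lra.
move=> x y; rewrite /real_dist ler_norml.
have := half x y; have := half y x; rewrite (DC y x) => yx xy.
by apply/andP; split; lra.
Qed.

Lemma nonexpansive_dist (a : Y) : nonexpansive (D a).
Proof.
move=> x y; rewrite /real_dist ler_norml.
have := qm_triangle hD a x y; have := qm_triangle hD a y x.
by rewrite (DC y x) => yx xy; apply/andP; split; lra.
Qed.

Lemma separated_subsequence (y : nat -> Y) (e : R) :
  (forall m, exists N, forall n, (N <= n)%N -> e <= D (y m) (y n)) ->
  exists2 u : nat -> nat, (forall i, (i <= u i)%N) &
    forall i j, i <> j -> e <= D (y (u i)) (y (u j)).
Proof.
move=> /choice[N NP].
(* [m.+1] makes [u] strictly increasing; [N m] places each index past the separation threshold of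
   its predecessor. *)
pose u i := iter i (fun m => maxn m.+1 (N m)) 0%N.
have uS i : (u i < u i.+1)%N by rewrite /= leq_max leqnn.
have u_ltn : {homo u : i j / (i < j)%N} by apply: homo_ltn uS; apply: ltn_trans.
have u_leq : {homo u : i j / (i <= j)%N} by apply: ltnW_homo.
have sep i j : (i < j)%N -> e <= D (y (u i)) (y (u j)).
  move=> ij; apply: NP; apply: leq_trans (u_leq _ _ ij).
  by rewrite /= leq_max leqnn orbT.
exists u => [|i j /eqP]; first by elim=> // i IH; apply: leq_ltn_trans (uS i).
by rewrite neq_ltn => /orP[/sep //|/sep]; rewrite DC.
Qed.

Lemma nonexpansive_Cauchy (y : nat -> Y) :
  (forall h, nonexpansive h -> left_K_Cauchy (@real_dist R) (h \o y)) ->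
  left_K_Cauchy D y.
Proof.
move=> cy.
have [returns|] := pselect (forall e : R, 0 < e ->
    exists m, forall N, exists2 n, (N <= n)%N & D (y m) (y n) < e).
  move=> e e0; have e4 : 0 < e / 4 by lra.
  have [m mP] := returns _ e4.
  have [N NP] := cy _ (nonexpansive_dist (y m)) _ e4.
  (* Compare [k] with a return time [n >= k]: [D (y m) (y n) < e / 4], and [D (y m)] varies by less
     than [e / 4] past [N]. *)
  have near_m k : (N <= k)%N -> D (y m) (y k) < e / 2.
    move=> Nk; have [n kn mn] := mP k; have := NP _ _ Nk kn.
    by rewrite /real_dist /= ltr_norml => /andP[_]; lra.
  exists N => k n Nk kn; have := near_m _ Nk; have := near_m _ (leq_trans Nk kn).
  have := qm_triangle hD (y k) (y n) (y m); rewrite (DC (y k) (y m)); lra.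
move=> /existsNP[e /not_implyP[e0 noreturn]]; exfalso.
have /separated_subsequence[u ui sep] m :
    exists N, forall n, (N <= n)%N -> e <= D (y m) (y n).
  apply: contrapT => noN; apply: noreturn; exists m => N.
  apply: contrapT => non; apply: noN; exists N => n Nn.
  by rewrite leNgt; apply/negP => mn; apply: non; exists n.
pose z i := y (u i.*2).
have zeven i : dist_to z (y (u i.*2)) <= 0.
  by rewrite -(qm_refl hD (y (u i.*2))) (dist_to_le z _ i).
(* An odd position differs from every even one, so separation applies to each term of [z]. *)
have zodd i : e <= dist_to z (y (u i.*2.+1)).
  apply: le_dist_to => n; apply: sep => /(congr1 odd).
  by rewrite /= !odd_double.
have [N NP] := cy _ (nonexpansive_dist_to z) _ e0.
have Neven : (N <= u N.*2)%N.
  by apply: leq_trans (ui _); rewrite -addnn leq_addr.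
have Nodd : (N <= u N.*2.+1)%N.
  by apply: leq_trans (ui _); rewrite -addnn -addnS leq_addr.
(* The left K-Cauchy bound needs ordered indices; symmetry of [real_dist] covers both orders. *)
have close : real_dist (dist_to z (y (u N.*2.+1))) (dist_to z (y (u N.*2))) < e.
  case/orP: (leq_total (u N.*2.+1) (u N.*2)) => le_u; first exact: NP.
  by rewrite /real_dist distrC; apply: NP.
move: close; rewrite /real_dist ltr_norml => /andP[_].
have := zeven N; have := zodd N; lra.
Qed.

End nonexpansive.

Theorem theorem5p7 (R : realType) (X Y : Type) (d : X -> X -> R)
    (rho : Y -> Y -> R) (f : X -> Y)
    (hd : is_quasi_metric d) (hrho : is_quasi_metric rho)
    (hY : forward_parallel_implies_backward_parallel rho) :
  left_K_Cauchy_regular d rho f <->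
  (forall h : Y -> R, forward_uniformly_continuous rho (@real_dist R) h ->
     left_K_Cauchy_regular d (@real_dist R) (h \o f)).
Proof.
split=> [cf h uh x /cf|cf x cx e e0].
  exact: (forward_uniformly_continuous_regular uh).
have hD := symmetrized_quasi_metric hrho.
have [|n0 n0P] := nonexpansive_Cauchy hD (symmetrizedC rho) (y := f \o x) _ e0.
  (* A function nonexpansive for [symmetrized rho] is forward uniformly continuous for [rho]: below
     [Num.min s (r / 2)], both summands of the symmetrized distance are less than [r / 2]. *)
  move=> h hh; apply: (cf h) cx => r r0.
  have r2 : 0 < r / 2 by lra.
  have [s s0 sP] := parallel_uniform hrho hY r2.
  exists (Num.min s (r / 2)) => [|a b]; first by rewrite lt_min s0.
  rewrite lt_min => /andP[/sP ba ab]; apply: le_lt_trans (hh a b) _.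
  by rewrite /symmetrized; lra.
exists n0 => k n n0k kn; apply: le_lt_trans (n0P _ _ n0k kn).
by rewrite /symmetrized lerDl qm_ge0.
Qed.
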